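(* Let $d\in\mathbb Z_+$ be fixed with $(p,d)=1$. For $\alpha\in\mathbb N$ and $k\in\mathbb Z_+$, we have $$\int_X d\mu_{k,q}^{(\alpha)}(x)=\widetilde\beta_{k,q}^{(\alpha)},$$ where $\mu_{k,q}^{(\alpha)}$ is the distribution on $X$ given by $\mu_{k,q}^{(\alpha)}(a+dp^N\mathbb Z_p)=\frac{[dp^N]_{q^\alpha}^k}{[dp^N]_q}\,q^a\,\widetilde\beta_{k,q^{dp^N}}^{(\alpha)}\left(\frac{a}{dp^N}\right)$ for $N\in\mathbb Z_+$, $0\le a<dp^N$.
   Context: $p$ is a fixed prime; $\mathbb C_p$ is the completion of an algebraic closure of $\mathbb Q_p$, with $|p|_p=1/p$. $\mathbb N$ is the set of positive integers, $\mathbb Z_+=\mathbb N\cup\{0\}$. $q\in\mathbb C_p$ satisfies $|1-q|_p<1$. $[x]_Q=\frac{1-Q^x}{1-Q}$ (so that $\lim_{Q\to1}[x]_Q=x$), and $[x]_Q^k$ means $([x]_Q)^k$. $X=X_d=\varprojlim_N(\mathbb Z/dp^N\mathbb Z)$, and $a+dp^N\mathbb Z_p$ denotes $\{x\in X: x\equiv a\pmod{dp^N}\}$. The integral is $\int_X d\mu(x)=\lim_{N\to\infty}\sum_{x=0}^{dp^N-1}\mu(x+dp^N\mathbb Z_p)$. The $q$-Bernoulli numbers with weight $\alpha$, $\widetilde\beta_{n,q}^{(\alpha)}$, are defined recursively by $\widetilde\beta_{0,q}^{(\alpha)}=1$ and, for $n\ge1$, $q\,(q^\alpha\widetilde\beta^{(\alpha)}+1)^n-\widetilde\beta_{n,q}^{(\alpha)}=\frac{\alpha}{[\alpha]_q}$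 if $n=1$ and $=0$ if $n>1$, where after binomial expansion $(\widetilde\beta^{(\alpha)})^l$ is replaced by $\widetilde\beta_{l,q}^{(\alpha)}$. The $q$-Bernoulli polynomials with weight $\alpha$ are $\widetilde\beta_{n,q}^{(\alpha)}(x)=\sum_{l=0}^n\binom nl[x]_{q^\alpha}^{n-l}q^{\alpha l x}\,\widetilde\beta_{l,q}^{(\alpha)}$. Replacing $q$ by $q^M$ gives $\widetilde\beta_{n,q^M}^{(\alpha)}(x)$; at $x=a/M$ one takes $(q^M)^{a/M}=q^a$. *)

(* Defs.v *)
From HB Require Import structures.
From mathcomp Require Import all_boot all_order all_algebra.
From mathcomp Require Import ring.
From mathcomp Require Import all_classical all_reals all_analysis.

Set Implicit Arguments.
Unset Strict Implicit.
Unset Printing Implicit Defensive.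
Import Order.TTheory GRing.Theory Num.Theory.
Local Open Scope classical_set_scope.
Local Open Scope ring_scope.

(* A complete field whose uniform structure comes from a multiplicative
   ultrametric absolute value with |p| = 1/p. *)
HB.mixin Record isPadicValued (p : nat) (R : realType) K
    of GRing.Field K & Uniform K := {
  pabs : K -> R ;
  pabs_ge0 : forall x, 0 <= pabs x ;
  pabs_eq0 : forall x, pabs x = 0 -> x = 0 ;
  pabsM : forall x y, pabs (x * y) = pabs x * pabs y ;
  pabs_ultra : forall x y, pabs (x + y) <= Num.max (pabs x) (pabs y) ;
  pabs_prime : pabs p%:R = p%:R^-1 ;
  entourage_pabs : @entourage K =
    filter_from [set e : R | 0 < e]
      (fun e => [set xy : K * K | pabs (xy.1 - xy.2) < e]) ;
  pabs_complete : forall F : set_system K, ProperFilter F -> cauchy F ->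
    exists l : K, F --> l
}.

#[short(type="padicValuedType")]
HB.structure Definition PadicValued (p : nat) (R : realType) :=
  {K of GRing.Field K & Uniform K & isPadicValued p R K}.

(* In a complete field whose absolute value restricts to the p-adic one on the
   rationals, the closure of the prime subfield is a copy of Q_p. *)
Definition Qp_in (p : nat) (R : realType) (K : padicValuedType p R) : set K :=
  closure (range (ratr : rat -> K)).

Definition algebraic_Qp (p : nat) (R : realType) (K : padicValuedType p R) :
    set K :=
  [set x | exists P : {poly K},
     [/\ P != 0, forall i, Qp_in P`_i & root P x]].

(* C_p, up to isometric isomorphism: a complete field in which the elements
   algebraic over Q_p are dense and form an algebraically closed field, that is,
   the completion of an algebraic closure of Q_p. *)
HB.mixin Record isPadicComplex (p : nat) (R : realType) K
    of PadicValued p R K := {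
  algebraic_Qp_closed : forall P : {poly K},
    (forall i, @algebraic_Qp p R K P`_i) -> (1 < size P)%N ->
    exists2 x : K, root P x & @algebraic_Qp p R K x ;
  algebraic_Qp_dense : dense (@algebraic_Qp p R K)
}.

#[short(type="padicComplexType")]
HB.structure Definition PadicComplex (p : nat) (R : realType) :=
  {K of PadicValued p R K & isPadicComplex p R K}.

(* [x]_Q, where u stands for Q^x; the value at Q = 1 is the limit x. *)
Definition qnum (K : fieldType) (Q x u : K) : K :=
  if Q == 1 then x else (1 - u) / (1 - Q).

Definition qnat (K : fieldType) (Q : K) (n : nat) : K :=
  qnum Q n%:R (Q ^+ n).

(* The sum is the umbral expansion of (Q^alpha b + 1)^n. *)
Definition is_qbern (K : fieldType) (alpha : nat) (Q : K) (b : nat -> K) :=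
  b 0%N = 1 /\
  forall n : nat, (0 < n)%N ->
    Q * (\sum_(l < n.+1) 'C(n, l)%:R * ((Q ^+ alpha) ^+ l * b l)) - b n =
    if n == 1%N then alpha%:R / qnat Q alpha else 0.

(* In characteristic 0, when Q is not a root of unity other than 1, existence
   and uniqueness are given by is_qbern_ex and is_qbern_uniq below. *)
Definition qbern (K : fieldType) (alpha : nat) (Q : K) : nat -> K :=
  xget (fun=> 0) [set b | is_qbern alpha Q b].

(* The value at x of the n-th polynomial, where u stands for Q^x: thus
   [x]_(Q^alpha) is computed from (Q^alpha)^x = u^alpha. *)
Definition qbern_poly (K : fieldType) (alpha : nat) (Q : K) (n : nat)
    (x u : K) : K :=
  \sum_(l < n.+1) 'C(n, l)%:R * qnum (Q ^+ alpha) x (u ^+ alpha) ^+ (n - l)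
                  * u ^+ (alpha * l) * qbern alpha Q l.

Section QBernoulliWellDefined.
Variables (K : fieldType) (alpha : nat) (Q : K).
Hypothesis K0 : forall n, n.+1%:R != 0 :> K.
Hypothesis Qroot : forall m, (0 < m)%N -> Q ^+ m = 1 -> Q = 1.

Let rhs n : K := if n == 1%N then alpha%:R / qnat Q alpha else 0.

Let next (s : seq K) : K :=
  let n := size s in
  if Q == 1 then (rhs n.+1 - \sum_(l < n) 'C(n.+1, l)%:R * s`_l) / n.+1%:R
  else if n == 0%N then 1
  else (rhs n - Q * \sum_(l < n) 'C(n, l)%:R * ((Q ^+ alpha) ^+ l * s`_l))
         / (Q * (Q ^+ alpha) ^+ n - 1).

Let Q_neq0 : Q != 1 -> forall n, Q * (Q ^+ alpha) ^+ n - 1 != 0.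
Proof.
move=> Q1 n; rewrite subr_eq0 -exprM -exprS; apply: contra Q1 => /eqP E.
by apply/eqP; apply: Qroot E.
Qed.

(* At Q = 1 the n-th relation determines the term of index n - 1, otherwise the
   term of index n. *)
Let rel_next (b : nat -> K) : (0 < alpha)%N ->
  is_qbern alpha Q b <-> forall n, b n = next (mkseq b n).
Proof.
move=> a0.
have nthb n (l : 'I_n) : (mkseq b n)`_l = b l by rewrite nth_mkseq.
rewrite /is_qbern /next; case: (eqVneq Q 1) => [Q1|Q1].
  have E n : Q * (\sum_(l < n.+2) 'C(n.+1, l)%:R * ((Q ^+ alpha) ^+ l * b l))
      - b n.+1 = \sum_(l < n) 'C(n.+1, l)%:R * b l + n.+1%:R * b n.
    rewrite Q1 mul1r; under eq_bigr => l _ do rewrite !expr1n mul1r.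
    by rewrite !big_ord_recr /= binn mul1r addrK binSn.
  have S n : \sum_(l < n) 'C(n.+1, l)%:R * (mkseq b n)`_l =
             \sum_(l < n) 'C(n.+1, l)%:R * b l.
    by apply: eq_bigr => l _; rewrite nthb.
  split=> [[b0 H] n|H].
    rewrite size_mkseq S /rhs -(H n.+1) // E addrC addKr mulrC mulKf //.
  split=> [|[|n] // _].
    rewrite H size_mkseq S big_ord0 subr0 /rhs /= /qnat /qnum Q1 eqxx.
    by rewrite divr1 divff //; case: alpha a0.
  rewrite E (H n) size_mkseq S mulrC divfK // addrCA subrr addr0 //.
have S n : \sum_(l < n) 'C(n, l)%:R * ((Q ^+ alpha) ^+ l * (mkseq b n)`_l) =
           \sum_(l < n) 'C(n, l)%:R * ((Q ^+ alpha) ^+ l * b l).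
  by apply: eq_bigr => l _; rewrite nthb.
have E n : Q * (\sum_(l < n.+1) 'C(n, l)%:R * ((Q ^+ alpha) ^+ l * b l)) - b n
    = Q * (\sum_(l < n) 'C(n, l)%:R * ((Q ^+ alpha) ^+ l * b l))
      + b n * (Q * (Q ^+ alpha) ^+ n - 1).
  by rewrite big_ord_recr /= binn; ring.
split=> [[b0 H] [|n]|H].
- by rewrite b0.
- by rewrite size_mkseq S /rhs -(H n.+1) // E /= addrC addKr mulfK // Q_neq0.
split=> [|[|n] // _]; first by rewrite H.
by rewrite E (H n.+1) size_mkseq S /= divfK ?Q_neq0 // addrCA subrr addr0.
Qed.

Lemma is_qbern_ex : (0 < alpha)%N -> exists b, is_qbern alpha Q b.
Proof.
move=> a0; pose s n := iter n (fun s => rcons s (next s)) [::].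
exists (fun n => next (s n)); apply/(rel_next _ a0) => n.
congr next; elim: n => //= n {1}->.
by rewrite /mkseq -addn1 iotaD map_cat cats1.
Qed.

Lemma is_qbern_uniq (b c : nat -> K) : (0 < alpha)%N ->
  is_qbern alpha Q b -> is_qbern alpha Q c -> b = c.
Proof.
move=> a0 /(rel_next _ a0) Hb /(rel_next _ a0) Hc.
have E n : mkseq b n = mkseq c n.
  elim: n => // n IH.
  by rewrite /mkseq -addn1 iotaD !map_cat -!/(mkseq _ _) /= IH Hb Hc IH.
by apply/funext => n; rewrite Hb Hc E.
Qed.

Lemma qbernP : (0 < alpha)%N -> is_qbern alpha Q (qbern alpha Q).
Proof. by move=> a0; apply: xgetPex; exact: is_qbern_ex. Qed.

End QBernoulliWellDefined.

(* The inverse limit of the Z/dp^N, as compatible families of residues. *)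
Record Xd (p d : nat) := MkXd {
  Xd_res : forall N, 'I_(d * p ^ N) ;
  Xd_compat : forall N, Xd_res N.+1 = Xd_res N %[mod d * p ^ N]
}.

(* a + dp^N Z_p *)
Definition cls (p d : nat) (a N : nat) : set (Xd p d) :=
  [set x | Xd_res x N = a %[mod d * p ^ N]].

(* The classes form a basis of the profinite topology and the classes of level
   N refine those of lower level, so a set is compact open exactly when it is a
   union of classes of one level. *)
Definition compact_open (p d : nat) (U : set (Xd p d)) : Prop :=
  exists (N : nat) (A : set nat), U = \bigcup_(a in A) cls a N.

Definition distribution_on (p d : nat) (V : zmodType) (mu : set (Xd p d) -> V) :=
  forall U W : set (Xd p d), compact_open U -> compact_open W ->
    U `&` W = set0 -> mu (U `|` W) = mu U + mu W.

Definition is_integral (p : nat) (R : realType) (K : padicComplexType p R)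
    (d : nat) (mu : set (Xd p d) -> K) (I : K) : Prop :=
  (fun N : nat => \sum_(x < d * p ^ N) mu (cls x N)) @ \oo --> I.

(* With M = dp^N, the base is q^M and (q^M)^(a/M) is q^a. *)
Definition mu_qbern (K : fieldType) (p d alpha k : nat) (q : K) (a N : nat) : K :=
  let M := (d * p ^ N)%N in
  qnat (q ^+ alpha) M ^+ k / qnat q M * q ^+ a
    * qbern_poly alpha (q ^+ M) k (a%:R / M%:R) (q ^+ a).

(* Main.v *)
Require Import Defs.
From HB Require Import structures.
From mathcomp Require Import all_boot all_order all_algebra.
From mathcomp Require Import ring.
From mathcomp Require Import all_classical all_reals all_analysis.

Set Implicit Arguments.
Unset Strict Implicit.
Unset Printing Implicit Defensive.
Import Order.TTheory GRing.Theory Num.Theory.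
Local Open Scope ring_scope.

(** The sums whose limit defines the integral do not depend on the level: each
    of them already equals the weighted q-Bernoulli number.  With [M = dp^N] and
    [b] the sequence of numbers at the base [q^M], the sum at level [N] is, in
    umbral notation,

      c_k = [M]_q^-1 * sum_(a < M) q^a ([a] + q^(alpha a) [M] b)^k

    where an unmarked bracket has base [q^alpha].  As
    [a+1] = 1 + q^alpha [a], the substitution of [c] for the umbra in
    q (q^alpha c + 1)^n raises [a] by one in each summand, so that
    q (q^alpha c + 1)^n - c_n telescopes to

      [M]^n / [M]_q * (q^M (q^(M alpha) b + 1)^n - b_n).

    The recursion for [b] at the base [q^M] turns this into the recursion for
    [c] at the base [q] ([qbern_mult_rec]), and a sequence that satisfies that
    recursion is unique ([qbern_mult]).  Umbral notation is made rigorous by the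
    linear functional [umbra b] on polynomials that sends ['X^n] to [b n].

    The division by [M] and the uniqueness of the recursive solution rest on
    characteristic 0, which the absolute value forces ([padic_char0]), and on
    [q] not being a root of unity other than 1. *)

(** * Umbral evaluation *)

Section Umbra.
Variables (K : fieldType) (b : nat -> K).

Definition umbra (P : {poly K}) : K := \sum_(i < size P) P`_i * b i.

Lemma umbra_widen (n : nat) (P : {poly K}) :
  (size P <= n)%N -> umbra P = \sum_(i < n) P`_i * b i.
Proof.
move=> le_Pn; rewrite /umbra (big_ord_widen n (fun i => P`_i * b i)) //.
rewrite big_mkcond; apply: eq_bigr => i _.
by case: ltnP => // le_Pi; rewrite nth_default ?mul0r.
Qed.

Lemma umbra_is_linear : linear_for *%R umbra.
Proof.
move=> x P Q.
have le_PQ : (size (x *: P + Q)%R <= maxn (size P) (size Q))%N.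
  rewrite (leq_trans (size_polyD _ _)) // geq_max leq_maxr andbT.
  by rewrite (leq_trans (size_scale_leq _ _)) // leq_maxl.
rewrite (umbra_widen le_PQ) (umbra_widen (leq_maxl (size P) (size Q))).
rewrite (umbra_widen (leq_maxr (size P) (size Q))) mulr_sumr -big_split /=.
by apply: eq_bigr => i _; rewrite coefD coefZ mulrDl mulrA.
Qed.

HB.instance Definition _ :=
  GRing.isLinear.Build K {poly K} K *%R umbra umbra_is_linear.

Lemma umbraXn (n : nat) : umbra 'X^n = b n.
Proof.
rewrite (@umbra_widen n.+1) ?size_polyXn // big_ord_recr /= coefXn eqxx mul1r.
rewrite big1 ?add0r // => i _.
by rewrite coefXn (ltn_eqF (ltn_ord i)) mul0r.
Qed.

Lemma umbra_binomial (x y : K) (n : nat) :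
  umbra ((x%:P + y *: 'X) ^+ n) =
  \sum_(l < n.+1) 'C(n, l)%:R * x ^+ (n - l) * y ^+ l * b l.
Proof.
rewrite exprDn linear_sum; apply: eq_bigr => l _.
rewrite -polyC_exp exprZn mul_polyC scalerA -scaler_nat scalerA linearZ /=.
by rewrite umbraXn mulrA.
Qed.

End Umbra.

(** Substitution of one umbra into another: both sides are linear in [P], and
    the hypothesis is their equality on the basis ['X^n]. *)
Lemma umbra_comp (K : fieldType) (b c : nat -> K) (m : nat)
    (w : 'I_m -> K) (T : 'I_m -> {poly K}) (P : {poly K}) :
  (forall n, c n = \sum_(a < m) w a * umbra b (T a ^+ n)) ->
  umbra c P = \sum_(a < m) w a * umbra b (P \Po T a).
Proof.
move=> cE.
under [RHS]eq_bigr => a _.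
  rewrite comp_polyE linear_sum mulr_sumr; over.
rewrite exchange_big; apply: eq_bigr => i _.
rewrite cE mulr_sumr; apply: eq_bigr => a _.
by rewrite linearZ /= mulrCA.
Qed.

(** * q-integers *)

Section Qnat.
Variable K : fieldType.
Implicit Type Q : K.

Lemma qnatE Q (n : nat) : qnat Q n = \sum_(i < n) Q ^+ i.
Proof.
rewrite /qnat /qnum; case: eqVneq => [->|Q1].
  by rewrite (eq_bigr (fun=> 1)) ?sumr_const ?card_ord // => i _; rewrite expr1n.
rewrite -[1 - Q ^+ n]opprB subrX1 -mulNr opprB mulrAC divff ?mul1r //.
by rewrite subr_eq0 eq_sym.
Qed.

Lemma qnatS Q (n : nat) : qnat Q n.+1 = 1 + Q * qnat Q n.
Proof.
rewrite !qnatE big_ord_recl expr0 mulr_sumr.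
by congr (_ + _); apply: eq_bigr => i _; rewrite -exprS.
Qed.

Section NotRoot.
Variable q : K.
Hypothesis char0 : forall n, n.+1%:R != 0 :> K.
Hypothesis q_not_root : forall m, (0 < m)%N -> q ^+ m = 1 -> q = 1.

Lemma expr_eq1_not_root (m : nat) : (0 < m)%N -> (q ^+ m == 1) = (q == 1).
Proof.
move=> m0; apply/eqP/eqP => [/q_not_root->//|->]; exact: expr1n.
Qed.

Lemma not_root_expr (M : nat) : (0 < M)%N ->
  forall m, (0 < m)%N -> (q ^+ M) ^+ m = 1 -> q ^+ M = 1.
Proof.
move=> M0 m m0; rewrite -exprM => /q_not_root ->; rewrite ?expr1n //.
by rewrite muln_gt0 M0.
Qed.

Lemma qnat_neq0 (n : nat) : (0 < n)%N -> qnat q n != 0.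
Proof.
rewrite /qnat /qnum; case: (eqVneq q 1) => [_|q1] n0; first by case: n n0.
by rewrite mulf_neq0 ?invr_eq0 // subr_eq0 eq_sym ?expr_eq1_not_root.
Qed.

(** The numerator of the first factor is the denominator of the second: this is
    [M]_Q [a/M]_(Q^M) = [a]_Q at the base Q = q^m. *)
Lemma qnat_qnum_div (m M a : nat) : (0 < m)%N -> (0 < M)%N ->
  qnat (q ^+ m) M * qnum ((q ^+ M) ^+ m) (a%:R / M%:R) ((q ^+ a) ^+ m) =
  qnat (q ^+ m) a.
Proof.
move=> m0 M0; rewrite /qnat /qnum -!exprM !expr_eq1_not_root ?muln_gt0 ?M0 //.
case: eqVneq => [_|q1].
  by rewrite mulrCA divff ?mulr1 //; case: M M0.
have qM : 1 - q ^+ (m * M) != 0.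
  by rewrite subr_eq0 eq_sym expr_eq1_not_root ?muln_gt0 ?m0.
by rewrite [(M * m)%N]mulnC [(a * m)%N]mulnC mulrC mulrA divfK.
Qed.

(** Both sides are the q-integer of [M * m] at the base [q]. *)
Lemma qnat_mul_base (m M : nat) : (0 < m)%N -> (0 < M)%N ->
  qnat (q ^+ m) M * qnat q m = qnat q M * qnat (q ^+ M) m.
Proof.
move=> m0 M0; rewrite /qnat /qnum !expr_eq1_not_root //.
case: eqVneq => [_|q1]; first by rewrite mulrC.
have q'1 n : (0 < n)%N -> 1 - q ^+ n != 0.
  by move=> n0; rewrite subr_eq0 eq_sym expr_eq1_not_root.
have := q'1 m m0; have := q'1 M M0; have := q'1 1%N isT; rewrite expr1.
rewrite -!exprM [(M * m)%N]mulnC => nz1 nzM nzm.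
by field; rewrite ?nz1 ?nzM ?nzm.
Qed.

End NotRoot.
End Qnat.

(** * The multiplication formula *)

Section Multiplication.
Variables (K : fieldType) (alpha M : nat) (q : K).
Hypothesis char0 : forall n, n.+1%:R != 0 :> K.
Hypothesis q_not_root : forall m, (0 < m)%N -> q ^+ m = 1 -> q = 1.
Hypotheses (alpha_gt0 : (0 < alpha)%N) (M_gt0 : (0 < M)%N).

Definition qbern_mult_sum (k : nat) : K :=
  \sum_(a < M) qnat (q ^+ alpha) M ^+ k / qnat q M * q ^+ a
    * qbern_poly alpha (q ^+ M) k (a%:R / M%:R) (q ^+ a).

Let b := qbern alpha (q ^+ M).

(** The affine function of the umbra [b] whose [k]-th power occurs in the
    summand of index [a]. *)
Let T (a : nat) : {poly K} :=
  (qnat (q ^+ alpha) a)%:P + (q ^+ (alpha * a) * qnat (q ^+ alpha) M) *: 'X.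

Let bP : is_qbern alpha (q ^+ M) b.
Proof. by apply: qbernP => //; apply: not_root_expr. Qed.

Let rec_umbra (Q : K) (c : nat -> K) (n : nat) :
  \sum_(l < n.+1) 'C(n, l)%:R * ((Q ^+ alpha) ^+ l * c l) =
  umbra c ((1%:P + Q ^+ alpha *: 'X) ^+ n).
Proof.
rewrite umbra_binomial; apply: eq_bigr => l _.
by rewrite expr1n mulr1 mulrA.
Qed.

(** Each factor [M]_(q^alpha) joins either [a/M], which it turns into the
    q-integer [a], or one power of the umbra. *)
Lemma qbern_mult_sum_umbra (k : nat) :
  qbern_mult_sum k = \sum_(a < M) (q ^+ a / qnat q M) * umbra b (T a ^+ k).
Proof.
apply: eq_bigr => a _.
rewrite umbra_binomial /qbern_poly 2!mulr_sumr; apply: eq_bigr => l _.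
rewrite -(qnat_qnum_div char0 q_not_root a alpha_gt0 M_gt0) //.
have le_lk : (l <= k)%N by rewrite -ltnS.
rewrite -{1}(subnK le_lk) exprD !exprMn_comm; try exact: mulrC.
rewrite -!exprM [(a * (_ * _))%N]mulnA [(a * alpha)%N]mulnC /b.
by ring.
Qed.

Lemma qbern_mult_rec : is_qbern alpha q qbern_mult_sum.
Proof.
have [b0 bS] := bP; have qM0 := qnat_neq0 char0 q_not_root M_gt0.
split=> [|n n0].
  rewrite qbern_mult_sum_umbra.
  have umb1 : umbra b 1 = 1 by rewrite -(expr0 'X) umbraXn.
  under eq_bigr => a _ do rewrite expr0 umb1 mulr1.
  by rewrite -mulr_suml -qnatE divff.
rewrite rec_umbra (umbra_comp _ qbern_mult_sum_umbra) qbern_mult_sum_umbra.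
have stepT a : (1%:P + q ^+ alpha *: 'X) ^+ n \Po T a = T a.+1 ^+ n.
  rewrite (rmorphXn (comp_poly (T a))) /= comp_polyD comp_polyZ comp_polyX.
  rewrite comp_polyC /T qnatS mulnS exprD -!mul_polyC !(polyCD, polyCM).
  by congr (_ ^+ n); ring.
under eq_bigr => a _ do rewrite stepT.
rewrite mulr_sumr -sumrB.
pose f a := q ^+ a / qnat q M * umbra b (T a ^+ n).
rewrite (eq_bigr (fun a : 'I_M => f a.+1 - f a)); last first.
  by move=> a _; rewrite /f exprS !mulrA.
(* The ends of the telescope are affine functions with a common factor [M],
   since [0] = 0; without it they are the two terms of the recursion for [b]. *)
rewrite -(big_mkord xpredT (fun a => f a.+1 - f a)) telescope_sumr // /f.
have -> : T M = qnat (q ^+ alpha) M *: (1%:P + (q ^+ M) ^+ alpha *: 'X).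
  rewrite /T -exprM mulnC scalerDr scalerA -[_ *: 1%:P]mul_polyC -polyCM mulr1.
  by congr (_ + _ *: _); exact: mulrC.
have -> : T 0%N = qnat (q ^+ alpha) M *: 'X.
  by rewrite /T qnatE big_ord0 muln0 mul1r add0r.
rewrite !exprZn !linearZ /= umbraXn -rec_umbra expr0 mul1r.
transitivity (qnat (q ^+ alpha) M ^+ n / qnat q M *
  (q ^+ M * (\sum_(l < n.+1)
    'C(n, l)%:R * (((q ^+ M) ^+ alpha) ^+ l * b l)) - b n)).
  by ring.
rewrite bS //; case: eqP => [->|_]; last by rewrite mulr0.
have nza := qnat_neq0 char0 q_not_root alpha_gt0.
have nzb : qnat (q ^+ M) alpha != 0.
  by apply: qnat_neq0 => //; apply: not_root_expr.
rewrite expr1 mulrACA [_ * alpha%:R]mulrC -mulrA; congr (_ * _).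
apply: (mulIf nza); rewrite mulVf // mulrAC qnat_mul_base //.
by rewrite -invfM mulfV // mulf_neq0.
Qed.

Lemma qbern_mult (k : nat) : qbern_mult_sum k = qbern alpha q k.
Proof.
congr (_ k); apply: (is_qbern_uniq char0 q_not_root alpha_gt0).
  exact: qbern_mult_rec.
exact: qbernP.
Qed.

End Multiplication.

(** * Characteristic of a field with a p-adic absolute value *)

Section Characteristic.
Variables (p : nat) (R : realType) (K : padicValuedType p R).
Hypothesis p_prime : prime p.

Let pV_gt0 : 0 < p%:R^-1 :> R.
Proof. by rewrite invr_gt0 ltr0n prime_gt0. Qed.

Let pV_lt1 : p%:R^-1 < 1 :> R.
Proof. by rewrite invf_lt1 ?ltr1n ?ltr0n ?prime_gt1 ?prime_gt0. Qed.

Lemma pabs0 : pabs (0 : K) = 0.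
Proof.
have := pabsM (p%:R : K) 0; rewrite mulr0 pabs_prime => E.
apply/eqP; apply: contraTT pV_lt1 => n0; rewrite -leNgt.
by rewrite (_ : p%:R^-1 = 1) //; apply: (mulIf n0); rewrite mul1r -E.
Qed.

Lemma pabs1 : pabs (1 : K) = 1.
Proof.
apply: (mulfI (lt0r_neq0 pV_gt0)).
by rewrite -(pabs_prime (s := K)) -pabsM !mulr1.
Qed.

Lemma pabs_nat_le1 (n : nat) : pabs (n%:R : K) <= 1.
Proof.
elim: n => [|n IHn]; first by rewrite pabs0 ler01.
by rewrite -addn1 natrD (le_trans (pabs_ultra _ _)) // ge_max IHn pabs1 lexx.
Qed.

(** If a prime [r] vanished in [K], then either [r = p], which has absolute
    value [1/p != 0], or Bezout would make [p] invertible by an integer, which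
    [|p| = 1/p < 1] excludes because integers have absolute value at most 1. *)
Lemma padic_char0 (n : nat) : n.+1%:R != 0 :> K.
Proof.
apply/negP => /natf0_pchar -/(_ isT) [r /andP[r_prime /eqP r0]].
have [E|neq_pr] := eqVneq p r.
  rewrite -E in r0.
  by have := pV_gt0; rewrite -(pabs_prime (s := K)) r0 pabs0 ltxx.
have co_pr : coprime p r.
  by rewrite prime_coprime // dvdn_prime2.
have [u v Euv _] := egcdnP r (prime_gt0 p_prime).
have up1 : u%:R * p%:R = 1 :> K.
  by rewrite -natrM Euv (eqP co_pr) natrD natrM r0 mulr0 add0r.
have : pabs (u%:R * p%:R : K) < 1.
  rewrite pabsM pabs_prime (le_lt_trans _ pV_lt1) //.
  by rewrite ler_piMl ?(ltW pV_gt0) ?pabs_nat_le1.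
by rewrite up1 pabs1 ltxx.
Qed.

End Characteristic.

Theorem theorem4 (p : nat) (R : realType) (Cp : padicComplexType p R)
    (d alpha k : nat) (q : Cp) (mu : set (Xd p d) -> Cp)
    (p_prime : prime p)
    (p_d_coprime : coprime p d)
    (alpha_gt0 : (0 < alpha)%N)
    (q_near1 : pabs (1 - q) < 1)
    (q_not_root : forall m : nat, (0 < m)%N -> q ^+ m = 1 -> q = 1)
    (mu_distr : distribution_on mu)
    (muE : forall N a : nat, (a < d * p ^ N)%N ->
       mu (cls a N) = mu_qbern p d alpha k q a N) :
  is_integral mu (qbern alpha q k).
Proof.
have d_gt0 : (0 < d)%N.
  case: d p_d_coprime {mu mu_distr muE} => // /eqP.
  by rewrite gcdn0 => p1; move: p_prime; rewrite p1.
rewrite /is_integral.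
rewrite (_ : (fun N : nat => _) = fun=> qbern alpha q k); first exact: cvg_cst.
apply/funext => N.
have M_gt0 : (0 < d * p ^ N)%N by rewrite muln_gt0 d_gt0 expn_gt0 prime_gt0.
rewrite -(qbern_mult (padic_char0 Cp p_prime) q_not_root alpha_gt0 M_gt0).
by apply: eq_bigr => a _; rewrite muE.
Qed.
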